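(* Let $\mathfrak{B}$ be a bornology on a metric space $X$ with a closed base. Let the ideal $\mathcal{I}$ on $\omega$ have a pseudounion. The following statements are equivalent. (1) $X$ satisfies $\mathrm{S}_1(\mathcal{I}\text{-}\Gamma_{\mathfrak{B}^s},\Gamma_{\mathfrak{B}^s})$. (2) $X$ satisfies $\mathrm{S}_1(\Gamma_{\mathfrak{B}^s},\Gamma_{\mathfrak{B}^s})$.
   Context: $(X,d)$ is an infinite metric space; $\omega$ is the set of natural numbers. A bornology $\mathfrak{B}$ on $X$ is a family of subsets of $X$ that is closed under subsets and finite unions and covers $X$. A base of $\mathfrak{B}$ is a subfamily $\mathfrak{B}_0\subseteq\mathfrak{B}$ such that every $B\in\mathfrak{B}$ is contained in some $B_0\in\mathfrak{B}_0$; it is a closed base if its members are closed. For $B\in\mathfrak{B}$, $\delta>0$: $B^\delta=\bigcup_{x\in B}\{y\in X:d(x,y)<\delta\}$. An ideal on $\omega$ is a family $\mathcal{I}\subseteq\mathcal{P}(\omega)$ closed under subsets and finite unions, containing all finite sets, with $\omega\notin\mathcal{I}$. A set $A\subseteq\omega$ is a pseudounion of $\mathcal{I}$ if $\omega\setminus A$ is infinite and $I\setminus A$ is finite for every $I\in\mathcal{I}$. Covers of $X$ never contain $X$ as an element. An open cover $\{U_n:n\in\omega\}$ (with its enumeration) is a $\gamma_{\mathfrak{B}^s}$-cover if it is infinite and for each $B\in\mathfrak{B}$ there are $n_0\in\omega$ and positive reals $\delta_n$ ($n\geq n_0$) with $B^{\delta_n}\subseteq U_n$ for all $n\geq n_0$;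 $\Gamma_{\mathfrak{B}^s}$ is the class of these. A countable open cover $\{U_n:n\in\omega\}$ (with its enumeration) is an $\mathcal{I}$-$\gamma_{\mathfrak{B}^s}$-cover if for each $B\in\mathfrak{B}$ there is a sequence $\{\delta_n\}$ of positive reals with $\{n\in\omega:B^{\delta_n}\nsubseteq U_n\}\in\mathcal{I}$; $\mathcal{I}\text{-}\Gamma_{\mathfrak{B}^s}$ is the class of these. $\mathrm{S}_1(\mathcal{A},\mathcal{B})$: for every sequence $\{A_n:n\in\omega\}$ of elements of $\mathcal{A}$ there are $a_n\in A_n$ ($n\in\omega$) such that $\{a_n:n\in\omega\}\in\mathcal{B}$ (for enumerated covers, with the enumeration $n\mapsto a_n$). *)

(* Defs.v *)
From mathcomp Require Import all_boot all_order all_algebra.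
From mathcomp Require Import all_classical all_reals all_analysis.

Set Implicit Arguments.
Unset Strict Implicit.
Unset Printing Implicit Defensive.

Import Order.TTheory GRing.Theory Num.Theory.
Local Open Scope classical_set_scope.
Local Open Scope ring_scope.

Definition subset_closed (T : Type) (F : set (set T)) : Prop :=
  forall A B : set T, A `<=` B -> F B -> F A.

Definition bornology (T : Type) (B : set (set T)) : Prop :=
  [/\ subset_closed B, setU_closed B & \bigcup_(C in B) C = setT].

Definition bornology_base (T : Type) (B B0 : set (set T)) : Prop :=
  B0 `<=` B /\ forall C, B C -> exists2 C0, B0 C0 & C `<=` C0.

Definition has_closed_base (T : topologicalType) (B : set (set T)) : Prop :=
  exists2 B0, bornology_base B B0 & forall C, B0 C -> closed C.

Definition enlargement (R : realType) (X : metricType R) (C : set X)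
    (delta : R) : set X :=
  \bigcup_(x in C) [set y | mdist x y < delta].

Definition ideal_on_nat (I : set (set nat)) : Prop :=
  [/\ subset_closed I, setU_closed I,
      (forall A, finite_set A -> I A) & ~ I setT].

Definition pseudounion (I : set (set nat)) (A : set nat) : Prop :=
  infinite_set (~` A) /\ forall J, I J -> finite_set (J `\` A).

(* Covers carry their enumeration, which may have repetitions. *)
Definition open_cover (X : topologicalType) (U : nat -> set X) : Prop :=
  [/\ forall n, open (U n), cover setT U = setT & forall n, U n <> setT].

Definition gamma_Bs (R : realType) (X : metricType R) (B : set (set X)) :
    set (nat -> set X) :=
  [set U | [/\ open_cover U, infinite_set (range U) &
    forall C, B C -> exists (n0 : nat) (delta : nat -> R),
      forall n, (n0 <= n)%N ->
        0 < delta n /\ enlargement C (delta n) `<=` U n]].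

Definition ideal_gamma_Bs (R : realType) (X : metricType R)
    (I : set (set nat)) (B : set (set X)) : set (nat -> set X) :=
  [set U | open_cover U /\
    forall C, B C -> exists2 delta : nat -> R, (forall n, 0 < delta n) &
      I [set n | ~ (enlargement C (delta n) `<=` U n)]].

Definition S1 (T : Type) (P Q : set (nat -> T)) : Prop :=
  forall A : nat -> nat -> T, (forall n, P (A n)) ->
    exists a : nat -> T, (forall n, range (A n) (a n)) /\ Q a.

(* Main.v *)
Require Import Defs.
From mathcomp Require Import all_boot all_order all_algebra.
From mathcomp Require Import all_classical all_reals all_analysis.

(** Neither implication changes the selection; what matters is how the two
    classes of covers compare.

    A gamma-cover is an I-gamma-cover because the finitely many indices before
    [n0] form a set in I ([gamma_ideal_gamma]), so the selection principle for
    I-gamma-covers applies to gamma-covers.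

    Conversely, let A be a pseudounion of I and let k enumerate points of
    the complement of A with k m >= m. Every J in I meets the complement of A
    in a finite set, so k m lies outside J for all large m. Hence the
    subsequence U o k of an I-gamma-cover U absorbs each member of the
    bornology, with an enlargement, from some index on
    ([ideal_gamma_subsequence]). What remains is that U o k has infinitely many
    distinct members, which is automatic ([eventually_absorbing_infinite]): a
    set occurring infinitely often would contain every point, while no member
    of a cover is the whole space. Members selected from the subsequences
    U_n o k are members of the U_n, so the selection principle for gamma-covers
    does the rest. *)

Set Implicit Arguments.
Unset Strict Implicit.
Unset Printing Implicit Defensive.

Import Order.TTheory GRing.Theory Num.Theory.
Local Open Scope classical_set_scope.
Local Open Scope ring_scope.

(** [P'] need not be included in [P]: passing to a subsequence of each cover is
    harmless, since a selection from it is a selection from the cover. *)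
Lemma S1_mono (T : Type) (P P' Q Q' : set (nat -> T)) :
  (forall U, P' U -> exists2 V, P V & range V `<=` range U) -> Q `<=` Q' ->
  S1 P Q -> S1 P' Q'.
Proof.
move=> PP' QQ' S A A_P'.
have /choice[V PV] n : exists V, P V /\ range V `<=` range (A n).
  by have [V ? ?] := PP' _ (A_P' n); exists V.
have [a [aV Qa]] := S V (fun n => (PV n).1).
exists a; split; last exact: QQ'.
by move=> n; apply: (PV n).2; exact: aV.
Qed.

Lemma finite_nat_bounded (A : set nat) :
  finite_set A -> exists N, forall n, A n -> (n < N)%N.
Proof.
move=> /finite_seqP[s ->]; exists (\max_(i <- s) i).+1 => n /= ns.
by rewrite ltnS; exact: leq_bigmax_seq.
Qed.

Lemma infinite_nat_unbounded (A : set nat) (m : nat) :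
  infinite_set A -> exists2 n, (m <= n)%N & A n.
Proof.
move=> Ainf; apply: contrapT => noA; apply: Ainf.
apply: (sub_finite_set _ (finite_II m)) => n An /=.
by rewrite ltnNge; apply/negP => mn; apply: noA; exists n.
Qed.

Section Bornology.
Context (R : realType) (X : metricType R) (B : set (set X)).
Hypothesis Bborn : bornology B.

Lemma bornology_set1 (x : X) : B [set x].
Proof.
have [Bsub _ BT] := Bborn.
have [C BC Cx] : (\bigcup_(C in B) C) x by rewrite BT.
by apply: Bsub BC => _ ->.
Qed.

Lemma sub_enlargement (C : set X) (delta : R) :
  0 < delta -> C `<=` enlargement C delta.
Proof. by move=> delta0 x Cx; exists x => //=; rewrite mdistxx. Qed.

Definition eventually_absorbing (U : nat -> set X) :=
  forall C, B C -> exists (n0 : nat) (delta : nat -> R),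
    forall n, (n0 <= n)%N -> 0 < delta n /\ enlargement C (delta n) `<=` U n.

Lemma eventually_absorbing_mem (U : nat -> set X) (x : X) :
  eventually_absorbing U -> exists n0, forall n, (n0 <= n)%N -> U n x.
Proof.
move=> /(_ _ (bornology_set1 x))[n0 [delta HU]]; exists n0 => n n0n.
have [delta0 subU] := HU n n0n.
by apply: subU; apply: sub_enlargement.
Qed.

Lemma eventually_absorbing_cover (U : nat -> set X) :
  eventually_absorbing U -> cover setT U = setT.
Proof.
move=> HU; apply/seteqP; split=> // x _.
by have [n0 Ux] := eventually_absorbing_mem x HU; exists n0 => //; exact: Ux.
Qed.

(** By the pigeonhole principle, a finite range would make some member recur
    infinitely often; each point lies in all late members, hence in that one. *)
Lemma eventually_absorbing_infinite (U : nat -> set X) :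
  (forall n, U n <> setT) -> eventually_absorbing U -> infinite_set (range U).
Proof.
move=> UT HU /finite_range_cst_subsequence[V [A Ainf AV]].
have VT : V = setT.
  apply/seteqP; split=> // x _.
  have [n0 Ux] := eventually_absorbing_mem x HU.
  have [n n0n /AV <-] := infinite_nat_unbounded n0 Ainf.
  exact: Ux.
have [n _ /AV Un] := infinite_nat_unbounded 0 Ainf.
by apply: (UT n); rewrite Un.
Qed.

Section Ideal.
Context (I : set (set nat)).

Lemma gamma_ideal_gamma :
  ideal_on_nat I -> gamma_Bs B `<=` ideal_gamma_Bs I B.
Proof.
move=> [_ _ Ifin _] U [Ucov _ HU]; split=> // C /HU[n0 [delta Hdelta]].
(* [delta] is unconstrained before [n0], so positive values are put there. *)
exists (fun n => if (n0 <= n)%N then delta n else 1).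
  by move=> n; case: ifPn => [/Hdelta[]|].
apply: Ifin; apply: (sub_finite_set _ (finite_II n0)) => n /=.
rewrite ltnNge => bad; apply/negP => n0n; apply: bad.
by rewrite n0n; have [] := Hdelta n n0n.
Qed.

(** The increasing enumeration of the complement of A would also do; it is
    enough that k tends to infinity, so k m is any point of it beyond m. *)
Lemma ideal_gamma_subsequence (A : set nat) (U : nat -> set X) :
  pseudounion I A -> ideal_gamma_Bs I B U ->
  exists k : nat -> nat, gamma_Bs B (U \o k).
Proof.
move=> [Ainf IA] [[Uopen _ UT] HU].
have /choice[k Hk] m : exists n, (m <= n)%N /\ ~ A n.
  by have [n mn An] := infinite_nat_unbounded m Ainf; exists n.
exists k.
have absorb : eventually_absorbing (U \o k).
  move=> C /HU[delta delta0 /IA/finite_nat_bounded[N HN]].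
  exists N, (delta \o k) => m Nm; split; first exact: delta0.
  have [mk nA] := Hk m; apply: contrapT => bad.
  by have := HN (k m) (conj bad nA); rewrite ltnNge (leq_trans Nm mk).
have UkT n : (U \o k) n <> setT by exact: UT.
split=> //; last exact: eventually_absorbing_infinite.
split=> [n||//]; first exact: Uopen.
exact: eventually_absorbing_cover.
Qed.

End Ideal.
End Bornology.

Theorem theorem3p15 (R : realType) (X : metricType R)
    (Xinf : infinite_set [set: X])
    (B : set (set X)) (Bborn : bornology B) (Bclosed : has_closed_base B)
    (I : set (set nat)) (Iideal : ideal_on_nat I)
    (Ipseudo : exists A : set nat, pseudounion I A) :
  S1 (ideal_gamma_Bs I B) (gamma_Bs B) <-> S1 (gamma_Bs B) (gamma_Bs B).
Proof.
split; apply: S1_mono => // U HU.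
  by exists U => //; exact: gamma_ideal_gamma.
have [A IA] := Ipseudo.
have [k Uk] := ideal_gamma_subsequence Bborn IA HU.
by exists (U \o k) => // _ [n _ <-]; exists (k n).
Qed.
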